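(* Consider the nonlinear control-affine system $$\dot{\mathbf{x}}(t)=\mathbf{f}(\mathbf{x}(t))+\mathbf{g}(\mathbf{x}(t))\mathbf{u}(t),\qquad \mathbf{y}(t)=\mathbf{h}(\mathbf{x}(t)),$$ with $\mathbf{f}:\mathbb{R}^n\to\mathbb{R}^n$, $\mathbf{g}:\mathbb{R}^n\to\mathbb{R}^{n\times m}$, $\mathbf{h}:\mathbb{R}^n\to\mathbb{R}^p$. Let $\mathbf{T}_{j,r}\in\mathbb{R}^{n\times r^j}$, $j=1,\dots,k$, be (truncated) transformation matrices with symmetric coefficients and let $\bar{\mathbf{z}}_r\in\mathbb{R}^r$ denote the reduced state. Define the embedding $\Phi_r:\mathbb{R}^r\to\mathbb{R}^n$ via $$\mathbf{x}\approx\Phi_r(\bar{\mathbf{z}}_r):=\mathbf{T}_{1,r}\bar{\mathbf{z}}_r+\mathbf{T}_{2,r}\bar{\mathbf{z}}_r^{\otimes2}+\cdots+\mathbf{T}_{k,r}\bar{\mathbf{z}}_r^{\otimes k},$$ for which the reduced Jacobian can be computed explicitly via $$\mathbf{J}_r(\bar{\mathbf{z}}_r):=\frac{\mathrm{d}\Phi_r(\bar{\mathbf{z}}_r)}{\mathrm{d}\bar{\mathbf{z}}_r}=\mathbf{T}_{1,r}+2\,\mathbf{T}_{2,r}(\bar{\mathbf{z}}_r\otimes\mathbf{I})+3\,\mathbf{T}_{3,r}(\bar{\mathbf{z}}_r\otimes\bar{\mathbf{z}}_r\otimes\mathbf{I})+\cdots\in\mathbb{R}^{n\times r}.$$ Thus,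 the nonlinear reduced-order model (ROM) for $\bar{\mathbf{z}}_r\in\mathbb{R}^r$ is $$\dot{\bar{\mathbf{z}}}_r=\underbrace{\mathbf{J}_r(\bar{\mathbf{z}}_r)^{\dagger}\,\mathbf{f}(\Phi_r(\bar{\mathbf{z}}_r))}_{=:\mathbf{f}_r(\bar{\mathbf{z}}_r)}+\underbrace{\mathbf{J}_r(\bar{\mathbf{z}}_r)^{\dagger}\,\mathbf{g}(\Phi_r(\bar{\mathbf{z}}_r))}_{=:\mathbf{g}_r(\bar{\mathbf{z}}_r)}\,\mathbf{u},\qquad \mathbf{y}_r=\underbrace{\mathbf{h}(\Phi_r(\bar{\mathbf{z}}_r))}_{=:\mathbf{h}_r(\bar{\mathbf{z}}_r)},$$ where $[\cdot]^\dagger$ denotes the Moore-Penrose pseudoinverse.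
   Context: Here $\mathbf{x}(t)\in\mathbb{R}^n$ is the full state, $\mathbf{u}(t)\in\mathbb{R}^m$ the input, $\mathbf{y}(t)\in\mathbb{R}^p$ the output, $\mathbf{y}_r$ the ROM output, and $r$ the reduced dimension. $\mathbf{z}^{\otimes j}$ is the $j$-fold Kronecker product and $\mathbf{I}$ is the $r\times r$ identity; the dots in the Jacobian continue in the same pattern up to the term $k\,\mathbf{T}_{k,r}(\bar{\mathbf{z}}_r^{\otimes(k-1)}\otimes\mathbf{I})$. $\mathbf{T}_{j,r}$ has symmetric coefficients if $\mathbf{T}_{j,r}(\mathbf{a}_1\otimes\cdots\otimes\mathbf{a}_j)=\mathbf{T}_{j,r}(\mathbf{a}_{\pi(1)}\otimes\cdots\otimes\mathbf{a}_{\pi(j)})$ for all $\mathbf{a}_1,\dots,\mathbf{a}_j\in\mathbb{R}^r$ and all permutations $\pi$ of $\{1,\dots,j\}$. The embedding is an approximation of the full state on the manifold $\{\Phi_r(\bar{\mathbf{z}}_r)\}$; the ROM is obtained by substituting $\Phi_r(\bar{\mathbf{z}}_r)$ for $\mathbf{x}$ in the system, giving $\mathbf{J}_r(\bar{\mathbf{z}}_r)\dot{\bar{\mathbf{z}}}_r=\mathbf{f}(\Phi_r(\bar{\mathbf{z}}_r))+\mathbf{g}(\Phi_r(\bar{\mathbf{z}}_r))\mathbf{u}$, and left-multiplying by the pseudoinverse of $\mathbf{J}_r(\bar{\mathbf{z}}_r)$. *)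

(* Defs.v *)
From HB Require Import structures.
From mathcomp Require Import all_boot all_order all_algebra.
From mathcomp Require Import all_classical all_reals all_analysis.
From mathcomp Require Import perm mxtens.

Set Implicit Arguments.
Unset Strict Implicit.
Unset Printing Implicit Defensive.

Import Order.TTheory GRing.Theory Num.Theory.
Import numFieldNormedType.Exports.

Local Open Scope classical_set_scope.
Local Open Scope ring_scope.

(* Vectors are columns. [A *t B] is the Kronecker product in the usual
   (row-major) ordering; only the casts needed to type it are added here. *)

(* a_0 ⊗ (a_1 ⊗ (... ⊗ a_(j-1))), equal to 1 when j = 0 *)
Fixpoint kronv (R : realType) (r j : nat) :
    ('I_j -> 'cV[R]_r) -> 'cV[R]_(r ^ j) :=
  match j return ('I_j -> 'cV[R]_r) -> 'cV[R]_(r ^ j) with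
  | 0 => fun _ => 1%:M
  | j'.+1 => fun a =>
      castmx (esym (expnS r j'), muln1 1)
        (a ord0 *t kronv (fun i => a (lift ord0 i)))
  end.

(* z^{⊗j}; the column count of the library power is 1 ^ j *)
Definition kronpow (R : realType) (r : nat) (z : 'cV[R]_r) (j : nat) :
    'cV[R]_(r ^ j) :=
  castmx (erefl, exp1n j) (z ^t j).

Lemma kronv_cst (R : realType) (r j : nat) (z : 'cV[R]_r) :
  kronv (fun _ : 'I_j => z) = kronpow z j.
Proof.
elim: j => [|j IH] /=.
  rewrite /kronpow (_ : exp1n 0 = erefl) ?castmx_id //; exact: eq_irrelevance.
rewrite IH /kronpow; case: j {IH} => [|j].
  apply/matrixP => i l; rewrite !castmxE/= !mxE !castmxE /= !mxE.
  rewrite !ord1 eqxx mulr1; congr (z _ _); apply: val_inj => //=.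
  by rewrite divn1.
apply/matrixP => i l; rewrite !castmxE ntensmxSS !mxE !castmxE /=.
congr GRing.mul; congr (fun_of_matrix _ _ _); apply: val_inj => //=;
  by rewrite exp1n.
Qed.

(* z^{⊗j} ⊗ I_r *)
Definition kronpow_id (R : realType) (r : nat) (z : 'cV[R]_r) (j : nat) :
    'M[R]_(r ^ j.+1, r) :=
  castmx (esym (expnSr r j), mul1n r) (kronpow z j *t (1%:M : 'M[R]_r)).

Definition symmetric_coeffs (R : realType) (n r j : nat)
    (T : 'M[R]_(n, r ^ j)) : Prop :=
  forall (a : 'I_j -> 'cV[R]_r) (s : 'S_j),
    T *m kronv a = T *m kronv (fun i => a (s i)).

(* The library's ['J] is for functions between row vectors. *)
Definition jacobian_cv (R : realType) (r n : nat) (F : 'cV[R]_r -> 'cV[R]_n)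
    (z : 'cV[R]_r) : 'M[R]_(n, r) :=
  \matrix_(i, j) ('d F z (delta_mx j 0)) i 0.

Lemma jacobian_cvE (R : realType) (r n : nat) (F : 'cV[R]_r -> 'cV[R]_n)
    (z v : 'cV[R]_r) : 'd F z v = jacobian_cv F z *m v.
Proof.
have vE : v = \sum_j v j 0 *: delta_mx j 0.
  by rewrite {1}[v]matrix_sum_delta; apply: eq_bigr => i _; rewrite big_ord1.
apply/matrixP => i l; rewrite ord1 {1}vE linear_sum summxE mxE.
by apply: eq_bigr => j _; rewrite linearZ !mxE mulrC.
Qed.

Definition is_moore_penrose (R : realType) (m n : nat) (A : 'M[R]_(m, n))
    (X : 'M[R]_(n, m)) : Prop :=
  [/\ A *m X *m A = A, X *m A *m X = X,
      (A *m X)^T = A *m X & (X *m A)^T = X *m A].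

Lemma moore_penrose_uniq (R : realType) (m n : nat) (A : 'M[R]_(m, n))
    (X Y : 'M[R]_(n, m)) :
  is_moore_penrose A X -> is_moore_penrose A Y -> X = Y.
Proof.
move=> [X1 X2 X3 X4] [Y1 Y2 Y3 Y4].
have AXY : A *m X = A *m Y.
  rewrite -X3 -{1}Y1 -mulmxA trmx_mul X3 Y3.
  by rewrite mulmxA X1.
have XAY : X *m A = Y *m A.
  rewrite -X4 -{1}Y1 -!mulmxA mulmxA trmx_mul X4 Y4.
  by rewrite -mulmxA (mulmxA A) X1.
by rewrite -X2 -mulmxA AXY mulmxA XAY.
Qed.

Lemma row_free_gram_unit (R : realType) (m n : nat) (A : 'M[R]_(m, n)) :
  row_free A -> A *m A^T \in unitmx.
Proof.
move=> Afree; rewrite -row_free_unit -kermx_eq0.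
apply/eqP/row_matrixP => i; rewrite row0.
set u := row i _.
have uK : u *m (A *m A^T) = 0.
  by apply/sub_kermxP; rewrite row_sub.
have uA : u *m A = 0.
  have : (u *m A) *m (u *m A)^T = 0.
    by rewrite trmx_mul mulmxA -(mulmxA u) uK mul0mx.
  move/matrixP/(_ 0 0); rewrite !mxE => /eqP.
  rewrite psumr_eq0 => [/allP uA0|j _]; last by rewrite !mxE -expr2 sqr_ge0.
  apply/rowP => j; have := uA0 j (mem_index_enum j).
  by rewrite /= !mxE -expr2 sqrf_eq0 => /eqP.
by apply/eqP; rewrite -(mulmx_free_eq0 _ Afree) uA.
Qed.

Lemma moore_penrose_ex (R : realType) (m n : nat) (A : 'M[R]_(m, n)) :
  exists X, is_moore_penrose A X.
Proof.
have [q [C [F [AE CU FU]]]] : exists q (C : 'M[R]_(m, q)) (F : 'M[R]_(q, n)),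
    [/\ A = C *m F, C^T *m C \in unitmx & F *m F^T \in unitmx].
  exists (\rank A), (col_base A), (row_base A); split.
  - by rewrite mulmx_base.
  - rewrite -{2}[col_base A]trmxK; apply: row_free_gram_unit.
    by rewrite /row_free mxrank_tr; exact: col_base_full.
  - by apply/row_free_gram_unit/row_base_free.
pose P := invmx (F *m F^T); pose Q := invmx (C^T *m C).
have PT : P^T = P by rewrite /P trmx_inv trmx_mul trmxK.
have QT : Q^T = Q by rewrite /Q trmx_inv trmx_mul trmxK.
pose X := F^T *m P *m (Q *m C^T).
have AX : A *m X = C *m Q *m C^T.
  rewrite AE /X -!mulmxA; congr (C *m _).
  by rewrite (mulmxA F) (mulmxA _ P) mulmxV // mul1mx.
have XA : X *m A = F^T *m P *m F.
  rewrite AE /X -!mulmxA; congr (_ *m (_ *m _)).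
  by rewrite (mulmxA _ C) (mulmxA Q) mulVmx // mul1mx.
exists X; split.
- by rewrite AX AE -!mulmxA (mulmxA _ C F) (mulmxA Q) mulVmx // mul1mx.
- rewrite XA /X -!mulmxA; congr (_ *m (_ *m _)).
  by rewrite (mulmxA F) (mulmxA _ P) mulmxV // mul1mx.
- by rewrite AX !trmx_mul trmxK QT mulmxA.
- by rewrite XA !trmx_mul trmxK PT mulmxA.
Qed.

Definition mpinv (R : realType) (m n : nat) (A : 'M[R]_(m, n)) : 'M[R]_(n, m) :=
  xget 0 [set X | is_moore_penrose A X].

Lemma mpinvP (R : realType) (m n : nat) (A : 'M[R]_(m, n)) :
  is_moore_penrose A (mpinv A).
Proof.
have [X AX] := moore_penrose_ex A.
exact: (xgetPex _ (ex_intro _ X AX)).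
Qed.

Definition control_affine (R : realType) (n m p : nat)
    (f : 'cV[R]_n -> 'cV[R]_n) (g : 'cV[R]_n -> 'M[R]_(n, m))
    (h : 'cV[R]_n -> 'cV[R]_p)
    (u : R -> 'cV[R]_m) (x : R -> 'cV[R]_n) (y : R -> 'cV[R]_p) (t : R) : Prop :=
  [/\ derivable x t 1, x^`()%classic t = f (x t) + g (x t) *m u t
    & y t = h (x t)].

(* T j stands for T_{j+1,r}, 0 <= j < k. *)
Definition embedding (R : realType) (n r k : nat)
    (T : forall j : 'I_k, 'M[R]_(n, r ^ j.+1)) (z : 'cV[R]_r) : 'cV[R]_n :=
  \sum_(j < k) T j *m kronpow z j.+1.

Definition reduced_jacobian (R : realType) (n r k : nat)
    (T : forall j : 'I_k, 'M[R]_(n, r ^ j.+1)) : 'cV[R]_r -> 'M[R]_(n, r) :=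
  jacobian_cv (embedding T).

Definition rom_f (R : realType) (n r k : nat)
    (T : forall j : 'I_k, 'M[R]_(n, r ^ j.+1))
    (f : 'cV[R]_n -> 'cV[R]_n) (z : 'cV[R]_r) : 'cV[R]_r :=
  mpinv (reduced_jacobian T z) *m f (embedding T z).

Definition rom_g (R : realType) (n m r k : nat)
    (T : forall j : 'I_k, 'M[R]_(n, r ^ j.+1))
    (g : 'cV[R]_n -> 'M[R]_(n, m)) (z : 'cV[R]_r) : 'M[R]_(r, m) :=
  mpinv (reduced_jacobian T z) *m g (embedding T z).

Definition rom_h (R : realType) (n p r k : nat)
    (T : forall j : 'I_k, 'M[R]_(n, r ^ j.+1))
    (h : 'cV[R]_n -> 'cV[R]_p) (z : 'cV[R]_r) : 'cV[R]_p :=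
  h (embedding T z).

(* Main.v *)
(* The j-fold Kronecker power is multilinear, so its differential at z in
   direction v is the sum over l of z ⊗ ... ⊗ v ⊗ ... ⊗ z with v in position l.
   Symmetry of T_j lets v be moved to the last position in each of these j
   terms, which turns their sum into j T_j (z^{⊗(j-1)} ⊗ I) v. The reduced-order
   model is then the chain rule combined with the Moore-Penrose identity
   J† J J† = J†; a solution dz = J† rhs lies in the range of J†, so the condition
   J† J dz = dz is automatic for it. *)
Require Import Defs.
From HB Require Import structures.
From mathcomp Require Import all_boot all_order all_algebra.
From mathcomp Require Import all_classical all_reals all_analysis.
From mathcomp Require Import perm mxtens.

Import Order.TTheory GRing.Theory Num.Theory.
Import numFieldNormedType.Exports.

Local Open Scope ring_scope.

Set Implicit Arguments.
Unset Strict Implicit.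
Unset Printing Implicit Defensive.

Lemma is_diff_sum (R : numFieldType) (V W : normedModType R) (k : nat)
    (F dF : 'I_k -> V -> W) (x : V) :
  (forall i, is_diff x (F i) (dF i)) ->
  is_diff x (fun y => \sum_i F i y) (fun v => \sum_i dF i v).
Proof.
move=> dFx.
have E (G : 'I_k -> V -> W) : (fun y => \sum_i G i y) = \sum_i G i.
  by apply/funext => y; rewrite fct_sumE.
rewrite !E; apply: (big_ind2 (fun f df => is_diff x f df)) => //.
  exact: is_diff_cst.
by move=> f df g dg ? ?; exact: is_diffD.
Qed.

(** Expanding in the basis of elementary matrices leaves only scalar functions multiplied by
    constant matrices. *)
Lemma is_diff_mx (R : realType) (V : normedModType R) (m n : nat)
    (F dF : V -> 'M[R]_(m, n)) (x : V) :
  (forall i j, is_diff x (fun y => F y i j : R) (fun v => dF v i j)) ->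
  is_diff x F dF.
Proof.
move=> dFx.
have E (G : V -> 'M[R]_(m, n)) :
    G = fun y => \sum_i \sum_j G y i j *: delta_mx i j.
  by apply/funext => y; rewrite -matrix_sum_delta.
rewrite (E F) (E dF); apply: is_diff_sum => i; apply: is_diff_sum => j.
have dFij := dFx i j.
exact: (is_diff_comp (g := fun c : R => c *: delta_mx i j)).
Qed.

Lemma is_diff_coord (R : realType) (m n : nat) (M : 'M[R]_(m, n)) i j :
  is_diff M (fun N : 'M[R]_(m, n) => N i j : R) (fun N => N i j).
Proof.
pose f (N : 'M[R]_(m, n)) : R := N i j.
have f_lin : linear f by move=> a N P; rewrite /f !mxE.
pose f_linear : {linear 'M[R]_(m, n) -> R} :=
  HB.pack f (GRing.isLinear.Build _ _ _ _ _ f_lin).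
apply: DiffDef; first exact: differentiable_coord.
by apply: (@diff_lin _ _ _ f_linear); exact: coord_continuous.
Qed.

Lemma is_diff_mulmx (R : realType) (V : normedModType R) (m n p : nat)
    (A : 'M[R]_(m, n)) (F dF : V -> 'M[R]_(n, p)) (x : V) :
  is_diff x F dF ->
  is_diff x (fun y => A *m F y) (fun v => A *m dF v).
Proof.
move=> dFx; apply: is_diff_mx => i j.
under eq_fun do rewrite mxE; under [X in is_diff _ _ X]eq_fun do rewrite mxE.
apply: is_diff_sum => l.
have dFlj := is_diff_comp (g := fun N : 'M[R]_(n, p) => N l j : R)
  dFx (is_diff_coord (F x) l j).
exact: (is_diffZ (A i l) dFlj).
Qed.

(** * Entries of Kronecker products *)

Lemma castmx_tensE (R : realType) (m n q : nat) (A : 'cV[R]_m) (B : 'cV[R]_n)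
    (E : (m * n)%N = q) (i : 'I_q) (a : 'I_m) (b : 'I_n) (l : 'I_1) :
  i = (a * n + b)%N :> nat ->
  castmx (E, muln1 1) (A *t B) i l = A a 0 * B b 0.
Proof.
move=> iE; rewrite castmxE.
have -> : cast_ord (esym (E, muln1 1).1) i = mxtens_index (a, b).
  exact: val_inj.
have -> : cast_ord (esym (E, muln1 1).2) l = mxtens_index (0 : 'I_1, 0 : 'I_1).
  by rewrite !ord1.
exact: tensmxE.
Qed.

Lemma tens_indexP (m n q : nat) (E : (m * n)%N = q) (i : 'I_q) :
  exists (a : 'I_m) (b : 'I_n), i = (a * n + b)%N :> nat.
Proof.
subst q; case: (mxtens_indexP i) => a b.
by exists a, b.
Qed.

Lemma kronvS (R : realType) (r j : nat) (b : 'I_j.+1 -> 'cV[R]_r) :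
  kronv b = castmx (esym (expnS r j), muln1 1)
    (b ord0 *t kronv (fun i => b (lift ord0 i))).
Proof. by []. Qed.

(** Associativity of the Kronecker product. The recursion of [kronv] splits off the first factor,
    whereas [kronpow_id] carries its identity block last. *)
Lemma kronv_recr (R : realType) (r j : nat) (b : 'I_j.+1 -> 'cV[R]_r) :
  kronv b = castmx (esym (expnSr r j), muln1 1)
    (kronv (fun i => b (widen_ord (leqnSn j) i)) *t b ord_max).
Proof.
elim: j b => [|j IH] b; apply/matrixP => i l.
  (* With a single factor, [i] itself indexes the vector; the empty product contributes index 0 and
     entry 1. *)
  have lt_ir : (i < r)%N by have := ltn_ord i; rewrite [X in (_ < X)%N]expn1.
  rewrite /= (@castmx_tensE _ _ _ _ _ _ _ _ (Ordinal lt_ir) ord0).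
    rewrite (@castmx_tensE _ _ _ _ _ _ _ _ ord0 (Ordinal lt_ir)) //.
    by rewrite !mxE mulrC (_ : ord_max = ord0) //; exact: val_inj.
  by rewrite /= muln1 addn0.
have [i1 [i' iE]] := tens_indexP (esym (expnS r j.+1)) i.
have [i2 [i3 i'E]] := tens_indexP (esym (expnSr r j)) i'.
(* The base-[r] digits of [i] are regrouped: [i1] and the block [i2] form the quotient by [r], and
   [i3] is the last digit. *)
have iE2 : i =
    (cast_ord (esym (expnS r j)) (mxtens_index (i1, i2)) * r + i3)%N :> nat.
  by rewrite iE i'E /= expnSr mulnDl mulnA addnA.
rewrite kronvS (castmx_tensE _ _ _ _ iE) (IH (fun q => b (lift ord0 q))).
rewrite (castmx_tensE _ _ _ _ i'E) (castmx_tensE _ _ _ _ iE2) kronvS.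
rewrite (@castmx_tensE _ _ _ _ _ _ _ _ i1 i2) //.
rewrite mulrA; congr (_ * _ * _).
- by congr (b _ _ _); exact: val_inj.
- congr (kronv _ _ _); apply/funext => q; congr b; exact: val_inj.
- by congr (b _ _ _); exact: val_inj.
Qed.

Lemma kronpow_idE (R : realType) (r j : nat) (z : 'cV[R]_r)
    (i : 'I_(r ^ j.+1)) (a : 'I_(r ^ j)) (b q : 'I_r) :
  i = (a * r + b)%N :> nat ->
  kronpow_id z j i q = kronpow z j a 0 * (b == q)%:R.
Proof.
move=> iE; rewrite castmxE.
have -> : cast_ord (esym (esym (expnSr r j), mul1n r).1) i = mxtens_index (a, b).
  exact: val_inj.
have -> : cast_ord (esym (esym (expnSr r j), mul1n r).2) q =
    mxtens_index (0 : 'I_1, q).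
  exact: val_inj.
by rewrite tensmxE mxE.
Qed.

(** This is w ⊗ v = (w ⊗ I) v for w = z^{⊗j}: in each row, the identity block selects one entry of
    v. *)
Lemma kronv_last (R : realType) (r j : nat) (z v : 'cV[R]_r) :
  kronv (fun i : 'I_j.+1 => if i == ord_max then v else z) =
  kronpow_id z j *m v.
Proof.
rewrite kronv_recr eqxx.
under [X in kronv X]eq_fun => i.
  rewrite (_ : _ == _ = false); last by rewrite -val_eqE /= ltn_eqF.
  over.
rewrite kronv_cst; apply/matrixP => i l; rewrite ord1.
have [i1 [i2 iE]] := tens_indexP (esym (expnSr r j)) i.
rewrite (castmx_tensE _ _ _ _ iE) !mxE (bigD1 i2) //= big1 => [|q /negPf qi2].
  by rewrite addr0 (kronpow_idE _ _ iE) eqxx mulr1.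
by rewrite (kronpow_idE _ _ iE) eq_sym qi2 mulr0 mul0r.
Qed.

(** * Differential of the Kronecker power and of the embedding *)

Lemma kronpowS (R : realType) (r j : nat) (z : 'cV[R]_r) :
  kronpow z j.+1 = castmx (esym (expnS r j), muln1 1) (z *t kronpow z j).
Proof. by rewrite -!kronv_cst. Qed.

(** Induction with the scalar product rule in each entry, after splitting off the first factor. *)
Lemma is_diff_kronpow (R : realType) (r j : nat) (z : 'cV[R]_r) :
  is_diff z (fun y => kronpow y j)
    (fun v => \sum_(l < j) kronv (fun i => if i == l then v else z)).
Proof.
elim: j => [|j IH].
  (* The empty power is constant; the vector 0 is a dummy, as ['I_0] has no element. *)
  rewrite (_ : (fun _ => _) = cst (kronv (fun=> 0 : 'cV[R]_r))); last first.
    by apply/funext => y; rewrite -kronv_cst.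
  apply: (is_diff_eq (is_diff_cst _ _)).
  by apply/funext => v; rewrite big_ord0.
set D := (X in is_diff _ _ X) in IH.
(* The term l = 0 differentiates the first factor and gives v ⊗ z^{⊗j}; the others keep z in front
   and sum to z ⊗ D v. *)
have -> : (fun v => \sum_(l < j.+1) kronv (fun i => if i == l then v else z)) =
  fun v => castmx (esym (expnS r j), muln1 1) (z *t D v) +
           castmx (esym (expnS r j), muln1 1) (v *t kronpow z j).
  apply/funext => v; rewrite big_ord_recl addrC /= kronv_cst.
  congr (_ + _); apply/matrixP => i l; rewrite castmxE !mxE !summxE mulr_sumr.
  by apply: eq_bigr => q _; rewrite castmxE !mxE.
apply: is_diff_mx => i l.
have [i1 [i2 iE]] := tens_indexP (esym (expnS r j)) i.
under eq_fun do rewrite kronpowS (castmx_tensE _ _ _ _ iE).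
under [X in is_diff _ _ X]eq_fun do
  rewrite mxE !(castmx_tensE _ _ _ _ iE) [X in _ + X]mulrC.
have d1 := is_diff_coord z i1 0.
have d2 := is_diff_comp (g := fun N : 'cV[R]_(r ^ j) => N i2 0 : R)
  IH (is_diff_coord (kronpow z j) i2 0).
exact: (is_diffM d1 d2).
Qed.

Lemma symmetric_kronv_subst (R : realType) (n r j : nat)
    (T : 'M[R]_(n, r ^ j.+1)) (z v : 'cV[R]_r) (l : 'I_j.+1) :
  symmetric_coeffs T ->
  T *m kronv (fun i => if i == l then v else z) = T *m kronpow_id z j *m v.
Proof.
move=> Tsym; rewrite -mulmxA -kronv_last (Tsym _ (tperm l ord_max)).
congr (_ *m kronv _); apply/funext => i.
(* The transposition sends [ord_max] to [l], so v now sits at [ord_max]. *)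
by rewrite -[X in _ == X](tpermR l ord_max) (inj_eq perm_inj).
Qed.

Lemma is_diff_embedding (R : realType) (n r k : nat)
    (T : forall j : 'I_k, 'M[R]_(n, r ^ j.+1)) (z : 'cV[R]_r) :
  (forall j : 'I_k, symmetric_coeffs (T j)) ->
  is_diff z (embedding T)
    (fun v => (\sum_(j < k) j.+1%:R *: (T j *m kronpow_id z j)) *m v).
Proof.
move=> Tsym.
have -> : (fun v => (\sum_(j < k) j.+1%:R *: (T j *m kronpow_id z j)) *m v) =
    fun v => \sum_(j < k) T j *m
      (\sum_(l < j.+1) kronv (fun i => if i == l then v else z)).
  apply/funext => v; rewrite mulmx_suml; apply: eq_bigr => j _.
  (* By symmetry all [j.+1] summands coincide, which produces the coefficient [j.+1]. *)
  rewrite mulmx_sumr (eq_bigr _ (fun l _ => symmetric_kronv_subst z v l (Tsym j))).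
  by rewrite sumr_const card_ord -scalemxAl scaler_nat.
by apply: is_diff_sum => j; apply: is_diff_mulmx; exact: is_diff_kronpow.
Qed.

(** * Jacobian, chain rule and pseudoinverse *)

Lemma is_diff_jacobian_cv (R : realType) (r n : nat) (F : 'cV[R]_r -> 'cV[R]_n)
    (z : 'cV[R]_r) (M : 'M[R]_(n, r)) :
  is_diff z F (mulmx M) -> jacobian_cv F z = M.
Proof.
by move=> dF; apply/matrixP => i j; rewrite mxE diff_val -colE mxE.
Qed.

Lemma derive1_comp_cv (R : realType) (r n : nat) (F : 'cV[R]_r -> 'cV[R]_n)
    (z : R -> 'cV[R]_r) (t : R) :
  derivable z t 1 -> differentiable F (z t) ->
  derivable (F \o z) t 1 /\
  (F \o z)^`()%classic t = jacobian_cv F (z t) *m z^`()%classic t.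
Proof.
move=> /derivable1_diffP dz dF.
have dFz : differentiable (F \o z) t by exact: differentiable_comp.
split; first exact/derivable1_diffP.
by rewrite !derive1E' // diff_comp // -jacobian_cvE.
Qed.

(** Full column rank yields a left inverse [B] of [A], which cancels the leading [A] in the first
    Penrose identity. *)
Lemma mpinv_full_col (R : realType) (m n : nat) (A : 'M[R]_(m, n)) :
  \rank A = n -> mpinv A *m A = 1%:M.
Proof.
move=> rkA; have [AXA _ _ _] := mpinvP A.
have /row_fullP[B BA] : row_full A by apply/eqP.
by rewrite -[LHS]mul1mx -BA -mulmxA (mulmxA A) AXA.
Qed.

Theorem proposition1 (R : realType) (n m p r k : nat)
    (f : 'cV[R]_n -> 'cV[R]_n) (g : 'cV[R]_n -> 'M[R]_(n, m))
    (h : 'cV[R]_n -> 'cV[R]_p)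
    (T : forall j : 'I_k, 'M[R]_(n, r ^ j.+1)) :
  (forall j : 'I_k, symmetric_coeffs (T j)) ->
  (* the Jacobian of the embedding *)
  (forall z : 'cV[R]_r,
    differentiable (embedding T) z /\
    reduced_jacobian T z = \sum_(j < k) j.+1%:R *: (T j *m kronpow_id z j)) /\
  (* the reduced-order model *)
  (forall (u : R -> 'cV[R]_m) (z : R -> 'cV[R]_r) (yr : R -> 'cV[R]_p) (t : R),
    derivable z t 1 ->
    let Phi : 'cV[R]_r -> 'cV[R]_n := embedding T in
    let J : 'M[R]_(n, r) := reduced_jacobian T (z t) in
    let dz : 'cV[R]_r := z^`()%classic t in
    let rhs : 'cV[R]_n := f (Phi (z t)) + g (Phi (z t)) *m u t in
    let ROM := control_affine (rom_f T f) (rom_g T g) (rom_h T h) u z yr t in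
    [/\ (* substituting Phi(z) for x in the full system *)
        control_affine f g h u (Phi \o z) yr t <->
          J *m dz = rhs /\ yr t = h (Phi (z t)),
        (* left-multiplying by the pseudoinverse of J, for any rank of J *)
        ROM <->
          [/\ mpinv J *m (J *m dz) = mpinv J *m rhs, mpinv J *m (J *m dz) = dz
             & yr t = h (Phi (z t))]
      & (* the same when J has full column rank *)
        \rank J = r ->
        (ROM <-> mpinv J *m (J *m dz) = mpinv J *m rhs /\ yr t = h (Phi (z t)))]).
Proof.
move=> Tsym.
have dPhi z := is_diff_embedding z Tsym.
split=> [z|u z yr t dz].
  have dz := dPhi z; split; first exact: ex_diff.
  exact: is_diff_jacobian_cv.
move=> Phi J v rhs ROM.
have [dPz dPzE] : derivable (Phi \o z) t 1 /\
    (Phi \o z)^`()%classic t = J *m v.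
  by apply: derive1_comp_cv => //; have := dPhi (z t); case.
have [_ XAX _ _] := mpinvP J.
(* Factoring J† out of both ROM terms leaves a single equation on the velocity. *)
have ROME : ROM <-> v = mpinv J *m rhs /\ yr t = h (Phi (z t)).
  have -> : mpinv J *m rhs = rom_f T f (z t) + rom_g T g (z t) *m u t.
    by rewrite mulmxDr mulmxA.
  by split=> [[_ vE yE]|[vE yE]]; split.
split.
- by rewrite -dPzE; split=> [[_ ? ?]|[? ?]]; split.
- rewrite ROME; split=> [[vE yE]|[PE PvE yE]]; last by rewrite -PE PvE.
  by rewrite {1 2 3}vE !mulmxA XAX.
- move=> rkJ; rewrite ROME (mulmxA (mpinv J) J v) mpinv_full_col // mul1mx.
  exact: iff_refl.
Qed.
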